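(* In the process described in the context, with high probability $|S(1,n)| = (1+o(1))\,n/e$; that is, for every $\delta>0$, $\mathbb P\big( \big| |S(1,n)| - n/e \big| \le \delta n \big)\to 1$ as $n\to\infty$. Moreover, with high probability, the symmetric difference between $S(1,n)$ and the set $\{x_k : 1\le k\le n,\ x_k\ge 1-1/e\}$ has size at most $\tilde O(\sqrt n)$; that is, there is a constant $C>0$ such that $$\mathbb P\Big( \big| S(1,n)\,\triangle\, \{x_k : 1\le k\le n,\ x_k\ge 1-1/e\} \big| \le C(\log n)^C\sqrt n \Big)\to 1 \quad\text{as } n\to\infty .$$
   Context: Let $x_1,x_2,\ldots$ be independent random variables, uniform on $[0,1]$. Define random finite sets (the ''memory'') $S(1,k)$, $k\ge 0$, by $S(1,0)=\{0\}$ and, for $k\ge 1$: if $x_k>\min S(1,k-1)$ then $S(1,k)=\big(S(1,k-1)\cup\{x_k\}\big)\setminus\{\min S(1,k-1)\}$, and otherwise $S(1,k)=S(1,k-1)\cup\{x_k\}$. ''With high probability'' means with probability tending to $1$ as $n\to\infty$. The notation $f(n)=\tilde O(g(n))$ means that there is a constant $C$ with $f(n)\le C(\log n)^C g(n)$ for all large $n$. Here $e$ is the base of the natural logarithm and $\triangle$ denotes symmetric difference. *)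

(* Defs.v *)
From HB Require Import structures.
From mathcomp Require Import all_boot all_order all_algebra.
From mathcomp Require Import finmap.
From mathcomp Require Import all_classical all_reals all_analysis.
Set Implicit Arguments. Unset Strict Implicit. Unset Printing Implicit Defensive.
Import Order.TTheory GRing.Theory Num.Theory.
Import numFieldNormedType.Exports.
Local Open Scope fset_scope.
Local Open Scope ring_scope.

(* Mutual independence: the product rule over every finite subfamily. *)
Definition mutually_independent d (T : measurableType d) (R : realType)
    (P : probability T R) (X : nat -> {RV P >-> R}) : Prop :=
  forall (J : {fset nat}) (A : nat -> set R), (forall j, measurable (A j)) ->
    P (\bigcap_(j in [set` J]) (X j @^-1` A j))%classic
    = (\prod_(j <- J) P (X j @^-1` A j)%classic)%E.

Definition uniform01 d (T : measurableType d) (R : realType)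
    (P : probability T R) (Y : {RV P >-> R}) : Prop :=
  forall A : set R, measurable A ->
    distribution P Y A = uniform_prob (@ltr01 R) A.

(* The seed of the iterated minimum is an element of S, so that the value is
   the minimum of S whenever S is nonempty; on fset0 it is the junk value 0. *)
Definition fset_min (R : realType) (S : {fset R}) : R :=
  \big[Num.min/head 0 S]_(y <- S) y.

Lemma fset_min_in (R : realType) (S : {fset R}) :
  S != fset0 -> fset_min S \in S.
Proof.
move=> S0; rewrite /fset_min big_seq; elim/big_ind : _ => //.
- have [y yS] := fset0Pn _ S0.
  have : y \in (S : seq R) by [].
  have -> : (head 0 S \in S) = (head 0 S \in (S : seq R)) by [].
  by case: (S : seq R) => // a s _; rewrite /= mem_head.
- by move=> a b aS bS; case: leP.
Qed.

Lemma fset_min_le (R : realType) (S : {fset R}) (y : R) :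
  y \in S -> fset_min S <= y.
Proof. by move=> yS; rewrite /fset_min; apply: (@ge_bigmin_seq _ _ _ _ _ y xpredT id). Qed.

(* The sequence is indexed from 0: the arrival numbered k.+1 is x k.  The
   memory is never empty (memory_neq0), so fset_min is always a true minimum. *)
Fixpoint memory (R : realType) (x : nat -> R) (k : nat) : {fset R} :=
  if k is k'.+1 then
    let S := memory x k' in
    if fset_min S < x k' then (x k' |` S) `\ fset_min S else x k' |` S
  else [fset 0].

Lemma memory_neq0 (R : realType) (x : nat -> R) (k : nat) :
  memory x k != fset0.
Proof.
apply/fset0Pn; exists (if k is k'.+1 then x k' else 0).
case: k => [|k] /=; first exact: fset11.
case: ifPn => [lt_x|_]; rewrite !inE eqxx // andbT.
by rewrite (gt_eqF lt_x).
Qed.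

Definition above_threshold (R : realType) (x : nat -> R) (n : nat) : {fset R} :=
  [fset y in [seq x k | k <- iota 0 n] | 1 - (expR 1)^-1 <= y].

Definition fset_symdiff (K : choiceType) (A B : {fset K}) : {fset K} :=
  (A `\` B) `|` (B `\` A).

(* Main.v *)
Require Import Defs.
From HB Require Import structures.
From mathcomp Require Import all_boot all_order all_algebra.
From mathcomp Require Import finmap.
From mathcomp Require Import all_classical all_reals all_analysis.
From mathcomp Require Import measurable_realfun ring lra.
Set Implicit Arguments. Unset Strict Implicit. Unset Printing Implicit Defensive.
Import Order.TTheory GRing.Theory Num.Theory.
Import numFieldNormedType.Exports.
Local Open Scope classical_set_scope.
Local Open Scope ring_scope.

(** Why the theorem holds.  Fix the threshold [t = 1 - 1/e] and look only at
    the elements of the memory lying below [t].  Give each of them the weight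
    [1 / (1 - y)] and let the potential be the total weight.  When the memory
    has its minimum [m] below [t], a uniform arrival [y] adds the weight of [y]
    when [y < t] and removes the weight of [m] when [y > m].  The expected gain
    is the integral of [1 / (1 - y)] over [[0, t]], that is [- ln (1 - t)], and
    the expected loss is [(1 - m) / (1 - m) = 1]: whatever the memory is, the
    two cancel exactly because [t] solves [- ln (1 - t) = 1].  When nothing lies
    below [t] (an idle step), the potential is [0] and its drift is [1].

    So the drift of the potential [Phi] is the indicator of idle steps
    ([potential_drift]) and [Phi * drift = 0] ([potential_idle]): the second
    moment of [Phi] grows only through its bounded increments, hence
    [E Phi^2 = O(n)] and [E Phi = O(sqrt n)] ([second_moment],
    [first_abs_moment]).  Taking expectations of the increments, the expected
    number of idle steps equals [E Phi - 1], so it is [O(sqrt n)] too.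

    Both halves of the symmetric difference are now controlled for every
    sequence of arrivals: weights are at least [1] below [t], so at most [Phi]
    elements of the memory lie below [t]; and an element above [t] can be thrown
    away only when it is the minimum, that is at an idle step, and then one at
    most ([card_symdiff]).  Markov's inequality with the factor [ln n] to spare
    gives the second claim.  For the first one, the number of distinct arrivals
    above [t], minus [n / e], has drift [0], hence absolute mean at most
    [sqrt n], and the size of the memory differs from that number by at most the
    size of the symmetric difference ([card_memory_deviation]).

    Almost surely the arrivals are distinct, but this is never isolated as an
    event: repetitions contribute to the increments a sum over a finite set of
    point indicators, whose integral vanishes ([Rintegral_fset_null]).

    Conditioning on the past is done by [Rintegral_update]: an expectation does
    not change when the last arrival is replaced by an independent uniform
    variable, which is integrated first.  It rests on a pi-lambda argument
    extending independence from cylinders to the sigma-algebra of the past, and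
    on Fubini's theorem. *)

(** * Integrals of bounded functions *)

Lemma bounded_integrable d (T : measurableType d) (R : realType)
    (P : probability T R) (f : T -> R) (M : R) :
  measurable_fun setT f -> (forall w, `|f w| <= M) ->
  P.-integrable setT (EFin \o f).
Proof.
move=> mf fM; apply: measurable_bounded_integrable => //.
  by rewrite -ge0_fin_numE//; exact: fin_num_measure.
exists M; split; first by rewrite num_real.
by move=> r Mr w _; exact: le_trans (fM w) (ltW Mr).
Qed.

Lemma Rintegral_bounded d (T : measurableType d) (R : realType)
    (P : probability T R) (f : T -> R) (M : R) :
  measurable_fun setT f -> (forall w, `|f w| <= M) ->
  `|\int[P]_w f w| <= M.
Proof.
move=> mf fM; have fi := bounded_integrable P mf fM.
apply: le_trans (le_normr_Rintegral _ fi) _ => //.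
have -> : M = \int[P]_w (cst M w).
  by rewrite Rintegral_cst//= probability_setT mulr1.
apply: le_Rintegral => //.
- by apply: (@bounded_integrable _ _ _ _ _ M) => [|w]; rewrite ?normr_id//;
    exact: measurableT_comp.
- exact: (@bounded_integrable _ _ _ _ _ `|M|).
Qed.

Lemma Rintegral_if d (T : measurableType d) (R : realType)
    (P : probability T R) (b : T -> bool) (c : R) :
  measurable [set w | b w] ->
  \int[P]_w (if b w then c else 0) = c * fine (P [set w | b w]).
Proof.
move=> mb; rewrite -(Rintegral_cst P mb c) [RHS]Rintegral_mkcond.
by apply: eq_Rintegral => w _; rewrite patchE mem_setE.
Qed.

(** * Resampling one arrival *)

(** The joint law of two independent variables is the product of their laws, so
    this is Fubini's theorem for that product. *)
Lemma Rintegral_independent d1 d2 d3 (T1 : measurableType d1)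
    (T2 : measurableType d2) (T3 : measurableType d3) (R : realType)
    (P : probability T1 R) (Y : {RV P >-> T2}) (Z : {RV P >-> T3})
    (F : T2 * T3 -> R) (M : R) :
  (forall A B, measurable A -> measurable B ->
     P (Y @^-1` A `&` Z @^-1` B) = (P (Y @^-1` A) * P (Z @^-1` B))%E) ->
  measurable_fun setT F -> (forall p, `|F p| <= M) ->
  \int[P]_w F (Y w, Z w) = \int[P]_w \int[distribution P Z]_z F (Y w, z).
Proof.
move=> YZ mF FM.
have mYZ : measurable_fun setT (fun w => (Y w, Z w)).
  by apply/measurable_fun_pairP; split; exact: measurable_funP.
pose W : {RV P >-> (T2 * T3)%type} :=
  HB.pack (fun w => (Y w, Z w)) (isMeasurableFun.Build _ _ _ _ _ mYZ).
have iF (Q : probability (T2 * T3)%type R) : Q.-integrable setT (EFin \o F).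
  exact: bounded_integrable FM.
rewrite /Rintegral; congr fine.
transitivity (\int[distribution P W]_p (F p)%:E)%E.
  rewrite integral_distribution //=; first exact/measurable_EFinP.
  apply: (bounded_integrable P (f := fun w => F (Y w, Z w)) (M := M)) => //.
  exact: (measurableT_comp mF mYZ).
transitivity (\int[distribution P Y \x distribution P Z]_p (F p)%:E)%E.
  by apply: eq_measure_integral => A mA _; apply/esym/product_measure_unique.
rewrite -(integral12_prod_meas1 (iF (distribution P Y \x distribution P Z)%E)).
pose g (x : T2) := \int[distribution P Z]_z F (x, z).
have mFx (x : T2) : measurable_fun setT (fun z => F (x, z)).
  exact: (measurableT_comp mF (pair1_measurable x)).
have gE : fubini_F (distribution P Z) (EFin \o F) = EFin \o g.
  apply/funext => x; rewrite /fubini_F /g /Rintegral /= fineK//.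
  by apply: (integrable_fin_num measurableT); exact: bounded_integrable (mFx x) _.
have mg : measurable_fun setT g.
  apply/measurable_EFinP; rewrite -gE; apply: measurable_fubini_F.
  exact: (iF (distribution P Y \x distribution P Z)%E).
have gM x : `|g x| <= M by apply: Rintegral_bounded.
rewrite gE integral_distribution //=; first exact/measurable_EFinP.
apply: (bounded_integrable P (f := g \o Y) (M := M)) => [|w]; last exact: gM.
exact: measurableT_comp.
Qed.

(** Measurability with respect to the first [n] coordinates, expressed without a
    sigma-algebra on sequences: [f] becomes measurable on every space where the
    first [n] coordinates are.  It gets used on the given space, on the product
    of the line with that space under the sigma-algebra of the past, and on the
    line, where a single coordinate varies. *)
Definition adapted (R : realType) (n : nat) (f : (nat -> R) -> R) : Prop :=
  forall (d : measure_display) (T : measurableType d) (X : nat -> T -> R),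
    (forall k, (k < n)%N -> measurable_fun setT (X k)) ->
    measurable_fun setT (fun w => f (X ^~ w)).

Definition update (R : Type) (x : nat -> R) (n : nat) (y : R) : nat -> R :=
  fun k => if k == n then y else x k.

Lemma adaptedS (R : realType) n (f : (nat -> R) -> R) :
  adapted n f -> adapted n.+1 f.
Proof. by move=> fad d T X mX; apply: fad => k /ltnW; exact: mX. Qed.

Lemma updateE (R : Type) (x : nat -> R) n y k : (k < n)%N -> update x n y k = x k.
Proof. by rewrite /update => /ltn_eqF ->. Qed.

Lemma update_same (R : Type) (x : nat -> R) n y : update x n y n = y.
Proof. by rewrite /update eqxx. Qed.

Lemma measurable_fun_id_measurableTypeR (R : realType) :
  measurable_fun setT (id : measurableTypeR R -> R).
Proof. by move=> _ A mA; rewrite setTI. Qed.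

(** The uniform law, transported to the line equipped with the measurable
    structure used for random variables; [uniform_prob] lives on
    [measurableTypeR R]. *)
Definition uniform01_law (R : realType) : probability R R :=
  distribution (uniform_prob (@ltr01 R) : probability (measurableTypeR R) R)
    (HB.pack (id : measurableTypeR R -> R)
      (isMeasurableFun.Build _ _ _ _ _ (@measurable_fun_id_measurableTypeR R))).

Lemma integral_uniform01_law (R : realType) (f : R -> \bar R) :
  measurable_fun setT f -> (forall x, 0 <= f x)%E ->
  (\int[uniform01_law R]_x f x = \int[lebesgue_measure]_(x in `[0%R, 1%R]) f x)%E.
Proof.
move=> mf f0; rewrite ge0_integral_distribution//.
by rewrite integral_uniform//= subr0 invr1 mul1e.
Qed.

Section independence.
Context (d : measure_display) (T : measurableType d) (R : realType).
Context (P : probability T R) (X : nat -> {RV P >-> R}).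
Context (Xindep : mutually_independent X) (Xunif : forall k, uniform01 (X k)).

Local Notation U := (uniform01_law R).

Definition past_cylinders (n : nat) : set (set T) :=
  [set E | exists2 A : nat -> set R, (forall j, measurable (A j)) &
     E = \bigcap_(j in `I_n) (X j @^-1` A j)].

Lemma measurable_past_cylinders n : past_cylinders n `<=` measurable.
Proof.
move=> E [A mA ->]; apply: fin_bigcap_measurable; first exact: finite_II.
by move=> j _; rewrite -[X in measurable X]setTI; exact: measurable_funP.
Qed.

Lemma setI_closed_past_cylinders n : setI_closed (past_cylinders n).
Proof.
move=> _ _ [A mA ->] [B mB ->]; exists (fun j => A j `&` B j).
  by move=> j; exact: measurableI.
by rewrite -bigcapI.
Qed.

Lemma past_cylindersT n : past_cylinders n setT.
Proof.
exists (fun=> setT) => //; apply/esym/seteqP; split => // w _ j _ //.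
Qed.

Lemma uniform01_preimage n B : measurable B -> P (X n @^-1` B) = U B.
Proof. move=> mB; exact: (Xunif n mB). Qed.

(** In the product rule over the first [n.+1] indices, the factors of the first
    [n] multiply up to [P E], by the product rule over these. *)
Lemma past_cylinders_indep n E B : past_cylinders n E -> measurable B ->
  P (E `&` X n @^-1` B) = (P E * U B)%E.
Proof.
move=> [A mA ->] mB.
pose J (m : nat) : {fset nat} := [fset j in iota 0 m]%fset.
have inJ m (j : nat) : (j \in J m) = (j < m)%N by rewrite inE mem_iota add0n.
have JE m : [set` J m] = `I_m by apply/seteqP; split => j /=; rewrite inJ.
have JS m : J m.+1 = (m |` J m)%fset.
  by apply/fsetP => j; rewrite in_fset1U !inJ ltnS leq_eqVlt.
have nJ : n \notin J n by rewrite inJ ltnn.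
pose A' j := if j == n then B else A j.
have mA' j : measurable (A' j) by rewrite /A'; case: ifP.
have A'A j : (j < n)%N -> A' j = A j by rewrite /A' => /ltn_eqF ->.
have A'n : A' n = B by rewrite /A' eqxx.
have := Xindep (J n.+1) mA'; rewrite JS big_fsetU1//= A'n uniform01_preimage//.
have -> : (\prod_(j <- J n) P (X j @^-1` A' j) =
           \prod_(j <- J n) P (X j @^-1` A j))%E.
  by apply: eq_big_seq => j; rewrite inJ => /A'A ->.
rewrite -(Xindep (J n) mA) -JS !JE muleC => <-; congr (P _).
rewrite IIS bigcap_setU bigcap_set1 A'n; congr (_ `&` _).
by apply: eq_bigcapr => j /= /A'A ->.
Qed.

(** For fixed [B], both sides are finite measures in [E]; they agree on the
    cylinders, which are stable under intersection, hence on the sigma-algebra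
    that these generate. *)
Lemma past_indep n E B : <<s past_cylinders n >> E -> measurable B ->
  P (E `&` X n @^-1` B) = (P E * U B)%E.
Proof.
move=> sE mB.
have mXB : measurable (X n @^-1` B).
  by rewrite -[X in measurable X]setTI; exact: measurable_funP.
have UBfin : U B \is a fin_num by exact: fin_num_measure.
have UB0 : 0 <= fine (U B) by rewrite fine_ge0.
pose m1 := mrestr P mXB; pose m2 := mscale (NngNum UB0) P.
have m2E C : m2 C = (P C * U B)%E.
  by rewrite -[U B]fineK// muleC.
suff : m1 E = m2 E by rewrite m2E.
apply: (g_sigma_algebra_measure_unique (past_cylinders n) _ (fun=> setT)) => //.
- exact: measurable_past_cylinders.
- by move=> _; exact: past_cylindersT.
- by rewrite bigcup_const.
- exact: setI_closed_past_cylinders.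
- move=> C GC; rewrite [RHS]m2E; exact: past_cylinders_indep.
- by move=> _; rewrite /m1 /mrestr; apply: le_lt_trans (probability_le1 P _) _;
    rewrite ?setTI ?ltry.
Qed.

Lemma measurable_past n k : (k < n)%N ->
  measurable_fun setT (X k : g_sigma_algebraType (past_cylinders n) -> R).
Proof.
move=> kn _ B mB; rewrite setTI; apply: sub_sigma_algebra.
exists (fun j => if j == k then B else setT).
  by move=> j; case: ifP.
apply/seteqP; split => w /=.
  by move=> Bw j _; case: eqP => // ->.
by move=> /(_ k kn); rewrite eqxx.
Qed.

Lemma measurable_past_id n :
  measurable_fun setT (id : T -> g_sigma_algebraType (past_cylinders n)).
Proof.
move=> _ E mE; rewrite setTI.
by apply: (smallest_sub (@sigma_algebra_measurable _ T)) mE;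
  exact: measurable_past_cylinders.
Qed.

(** The conditional expectation given the first [n] arrivals is computed by
    integrating out the arrival of index [n]. *)
Lemma Rintegral_update n (f : (nat -> R) -> R) (M : R) :
  adapted n.+1 f -> (forall x, `|f x| <= M) ->
  \int[P]_w f (X ^~ w) = \int[P]_w \int[U]_y f (update (X ^~ w) n y).
Proof.
move=> fad fM.
pose G := g_sigma_algebraType (past_cylinders n).
(* The sample point, seen only through the sigma-algebra of the past. *)
pose Y : {RV P >-> G} :=
  HB.pack (id : T -> G) (isMeasurableFun.Build _ _ _ _ _ (@measurable_past_id n)).
pose F (p : G * R) := f (update (X ^~ p.1) n p.2).
have mF : measurable_fun setT F.
  apply: (fad _ (G * R)%type (fun k (p : G * R) => update (X ^~ p.1) n p.2 k)) => k.
  rewrite /update; case: eqP => [_ _|/eqP kn]; first exact: measurable_snd.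
  rewrite ltnS leq_eqVlt (negbTE kn) /= => {}kn.
  exact: measurableT_comp (measurable_past kn) measurable_fst.
transitivity (\int[P]_w F (Y w, X n w)).
  apply: eq_Rintegral => w _; congr f; apply/funext => k.
  by rewrite /update; case: eqP => // ->.
rewrite (Rintegral_independent (M := M)) //.
- apply: eq_Rintegral => w _; congr fine.
  apply: eq_measure_integral => A mA _.
  exact: uniform01_preimage.
- move=> A B mA mB; rewrite [in RHS]uniform01_preimage//.
  exact: past_indep.
- by move=> p; exact: fM.
Qed.

End independence.

(** * The critical threshold and the weight of an element *)

Definition threshold (R : realType) : R := 1 - (expR 1)^-1.

(** The expected loss at a minimum [m] below the threshold is [weight m] times
    the probability that a uniform arrival exceeds [m].  The weight is the
    inverse of that probability, also for negative [m], for which both are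
    [1]. *)
Definition weight (R : realType) (y : R) : R :=
  if y < threshold R then (1 - Num.max y 0)^-1 else 0.

Section weight.
Context (R : realType).
Implicit Types y : R.
Local Notation t := (threshold R).
Local Notation U := (uniform01_law R).
Local Notation mu := (@lebesgue_measure R).

Lemma expR1_gt0 : 0 < (expR 1)^-1 :> R.
Proof. by rewrite invr_gt0 expR_gt0. Qed.

Lemma expR1_lt1 : (expR 1)^-1 < 1 :> R.
Proof. by rewrite invf_lt1 ?expR_gt0// expR_gt1. Qed.

Lemma threshold_gt0 : 0 < t.
Proof. by rewrite subr_gt0 expR1_lt1. Qed.

Lemma threshold_lt1 : t < 1.
Proof. by rewrite gtrBl expR1_gt0. Qed.

Lemma weight_ge0 y : 0 <= weight y.
Proof.
rewrite /weight; case: ifP => // yt; rewrite invr_ge0 subr_ge0.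
by rewrite ge_max ler01 andbT ltW// (lt_trans yt threshold_lt1).
Qed.

Lemma le_weight y : weight y <= expR 1.
Proof.
rewrite /weight; case: ifP => [yt|_]; last exact: expR_ge0.
have m1 : 0 < 1 - Num.max y 0.
  by rewrite subr_gt0 gt_max ltr01 andbT (lt_trans yt threshold_lt1).
rewrite -[leRHS]invrK lef_pV2 ?posrE ?expR1_gt0//.
by rewrite lerBrDr addrC -lerBrDr ge_max (ltW yt)/= ltW// threshold_gt0.
Qed.

Lemma weight_ge1 y : y < t -> 1 <= weight y.
Proof.
rewrite /weight => yt; rewrite yt invf_ge1.
  by rewrite lerBlDr lerDl le_max lexx orbT.
by rewrite subr_gt0 gt_max ltr01 andbT; exact: lt_trans yt threshold_lt1.
Qed.

Lemma weightE y : weight y = if y < 0 then 1 else if y < t then (1 - y)^-1 else 0.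
Proof.
rewrite /weight; case: (ltP y 0) => // y0.
by rewrite (lt_trans y0 threshold_gt0) subr0 invr1.
Qed.

Lemma measurable_weight : measurable_fun setT (@weight R).
Proof.
(* The power function is measurable everywhere, and agrees with the inverse
   below the threshold, where the base is positive. *)
have -> : @weight R = fun y => if y < t then (1 - Num.max y 0) `^ (-1) else 0.
  apply/funext => y; rewrite /weight; case: ifP => // yt.
  rewrite powR_inv1// subr_ge0 ge_max ler01 andbT ltW//.
  exact: lt_trans yt threshold_lt1.
apply: measurable_fun_ifT => //; first exact: measurable_fun_ltr.
apply: (measurableT_comp (measurable_powR (-1))).
by apply: measurable_funB => //; exact: measurable_maxr.
Qed.

Lemma uniform01_lawE A : measurable A -> U A = mu (A `&` `[0, 1]).
Proof.
move=> mA; have := @integral_uniform01_law R (fun x => (\1_A x)%:E).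
rewrite !integral_indic// setIT; apply=> //.
  by apply/measurable_EFinP; exact: measurable_indic.
Qed.

Lemma uniform01_law_ray b m : m < 1 ->
  U [set` Interval (BSide b m) +oo%O] = (1 - Num.max m 0)%:E.
Proof.
move=> m1; rewrite uniform01_lawE//.
have [m0|m0] := ltP m 0.
  have -> : [set` Interval (BSide b m) +oo%O] `&` `[0, 1] = `[0, 1]%classic.
    apply/setIidr => y /=; rewrite !in_itv /= andbT => /andP[y0 _].
    have my := lt_le_trans m0 y0; by case: b => //=; exact: ltW.
  by rewrite lebesgue_measure_itv /= lte_fin ltr01 -EFinB !subr0.
have -> : [set` Interval (BSide b m) +oo%O] `&` `[0, 1] =
          [set` Interval (BSide b m) (BRight 1)].
  apply/seteqP; split => y /=; rewrite !in_itv /= andbT.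
    by move=> [-> /andP[_ ->]].
  move=> /andP[my ->]; split => //; rewrite andbT (le_trans m0)//.
  by case: b my => //= /ltW.
by rewrite lebesgue_measure_itv /= lte_fin m1 -EFinB.
Qed.

Lemma uniform01_law_set1 z : U [set z] = 0%E.
Proof.
apply/eqP; rewrite eq_le measure_ge0 andbT uniform01_lawE//.
rewrite -[leRHS](lebesgue_measure_set1 z); apply: le_measure; rewrite ?inE//.
  exact: measurableI.
Qed.

(** The integral is [- ln (1 - t)]: this identity is what singles out
    [t = 1 - 1/e]. *)
Lemma Rintegral_weight : \int[U]_y weight y = 1.
Proof.
rewrite /Rintegral integral_uniform01_law; first last.
- by move=> y; rewrite lee_fin weight_ge0.
- by apply/measurable_EFinP; exact: measurable_weight.
have t0 := threshold_gt0; have t1 := threshold_lt1.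
pose f (y : R) := (1 - y)^-1; pose F (y : R) := - ln (1 - y).
have FE (y : R) : y < 1 -> is_derive y (1 : R) F (f y).
  move=> y1; rewrite /F /f.
  have d1 : is_derive (1 - y) (1 : R) (@ln R) (1 - y)^-1.
    by apply: is_derive1_ln; rewrite subr_gt0.
  have d2 : is_derive y (1 : R) (fun y : R => 1 - y) (0 - 1) by apply: is_deriveB.
  have d3 : is_derive y (1 : R) (@ln R \o (fun y : R => 1 - y)) ((1 - y)^-1 * (0 - 1)).
    exact: is_derive1_comp.
  have -> : (1 - y)^-1 = - ((1 - y)^-1 * (0 - 1)) by rewrite sub0r mulrN1 opprK.
  exact: is_deriveN.
have F_cont y : y < 1 -> {for y, continuous F}.
  move=> y1; apply: differentiable_continuous; apply/derivable1_diffP.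
  by case: (FE y y1).
have f_cont (y : R) : y < 1 -> {for y, continuous f}.
  move=> y1; apply: continuous_comp; first by apply: continuousB; [exact: cst_continuous|exact: id].
  by apply: inv_continuous; rewrite gt_eqF// subr_gt0.
have fin_lt1 (y : R) : y \in `[0, t] -> y < 1.
  by rewrite in_itv /= => /andP[_ /le_lt_trans]; exact.
have fcw : {within `[0, t], continuous f}.
  by apply: continuous_in_subspaceT => y /[!inE] /fin_lt1; exact: f_cont.
transitivity (fine (\int[mu]_(y in `[0, t]) (f y)%:E)); last first.
  rewrite (@continuous_FTC2 _ f F 0 t)//.
  - have -> : F t = 1 by rewrite /F /threshold subKr lnV ?posrE ?expR_gt0// expRK opprK.
    have -> : F 0 = 0 by rewrite /F subr0 ln1 oppr0.
    by rewrite -EFinB subr0.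
  - split.
    + by move=> y /subset_itv_oo_cc/fin_lt1 /FE [].
    + by apply: cvg_at_right_filter; exact: F_cont.
    + by apply: cvg_at_left_filter; exact: F_cont.
  - move=> y /subset_itv_oo_cc/fin_lt1 /FE [_ Fy].
    by rewrite derive1E.
congr fine.
transitivity (\int[mu]_(y in `[0%R, t[) (f y)%:E)%E; last first.
  apply: integral_itv_bndo_bndc; apply/measurable_EFinP.
  apply: (@measurable_funS _ _ _ _ `[0, t]) => //.
    by apply: subset_itvl; rewrite bnd_simp.
  exact: subspace_continuous_measurable_fun.
have -> : [set` Interval (BLeft 0) (BLeft t)] = `[0, 1] `&` `[0, t[ :> set R.
  apply/esym/setIidr => y /=; rewrite !in_itv /= => /andP[-> /lt_trans].
  by move=> /(_ _ t1) /ltW.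
rewrite integral_mkcondr; apply: eq_integral => y.
rewrite inE /= in_itv /= => /andP[y0 y1]; rewrite patchE weightE.
by rewrite ltNge y0 mem_setE in_itv /= y0; case: ifP.
Qed.

End weight.

(** * Sums over the memory, and their measurability *)

Section fset_sums.
Context (R : realType).
Implicit Types (S : {fset R}) (g : R -> R) (x : nat -> R).

Lemma fset_sum_pred1 S g y :
  \sum_(z <- S) (if z == y then g z else 0) = if y \in S then g y else 0.
Proof.
case: ifPn => yS; last first.
  rewrite big_seq big1// => z zS; case: eqP => // zy.
  by rewrite -zy zS in yS.
rewrite (big_fsetD1 y)//= eqxx big_seq big1 ?addr0// => z.
by rewrite !inE => /andP[/negbTE ->].
Qed.

Lemma fset_sumU1 S g y :
  \sum_(z <- (y |` S)%fset) g z =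
  \sum_(z <- S) g z + (g y - \sum_(z <- S) (if z == y then g z else 0)).
Proof.
rewrite fset_sum_pred1; case: ifPn => yS; last by rewrite big_fsetU1//= subr0 addrC.
by rewrite subrr addr0 mem_fset1U.
Qed.

(** Linear bookkeeping of one step: the arrival enters, the minimum leaves if it
    is smaller, and the last sum undoes the entrance of an arrival that was
    already present. *)
Lemma memory_sumS x n g :
  let S := memory x n in
  \sum_(z <- memory x n.+1) g z =
  \sum_(z <- S) g z + (g (x n) -
    (if fset_min S < x n then g (fset_min S) else 0) -
    \sum_(z <- S) (if z == x n then g z else 0)).
Proof.
move=> S; rewrite /= -/S; case: ifPn => mx; last by rewrite fset_sumU1 subr0.
have mS := fset_min_in (memory_neq0 x n).
have := fset_sumU1 S g (x n).
by rewrite (big_fsetD1 (fset_min S)) ?inE ?mS ?orbT//= => /(canRL (addKr _)) ->; ring.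
Qed.

(** Expressing the minimum through sums reduces its measurability to that of
    sums. *)
Lemma fset_min_ltP S a : S != fset0 ->
  (fset_min S < a) = (0 < \sum_(z <- S) (if z < a then 1 else 0 : R)).
Proof.
move=> S0; apply/idP/idP => [ma|].
  rewrite (big_fsetD1 _ (fset_min_in S0))/= ma ltr_pwDl// sumr_ge0// => z _.
  by case: ifP.
apply: contraTT; rewrite -!leNgt => am; rewrite big_seq big1// => z zS.
by rewrite ltNge (le_trans am (fset_min_le zS)).
Qed.

Lemma fset_sum1 S : \sum_(z <- S) (1 : R) = #|` S|%:R.
Proof. by rewrite big_const_seq count_predT iter_addr_0. Qed.

End fset_sums.

Lemma measurable_fset_min (R : realType) d (T : measurableType d)
    (S : T -> {fset R}) :
  (forall w, S w != fset0) ->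
  (forall g : R -> R, measurable_fun setT g ->
     measurable_fun setT (fun w => \sum_(y <- S w) g y)) ->
  measurable_fun setT (fun w => fset_min (S w)).
Proof.
move=> S0 mS.
apply: (measurability _ (RGenInftyO.measurableE R)) => _ [_ [a ->] <-].
rewrite setTI.
have mlt : measurable_fun setT (fun y : R => if y < a then 1 else 0 : R).
  by apply: measurable_fun_ifT => //; exact: measurable_fun_ltr.
have := measurable_fun_ltr (measurable_cst (0 : R)) (mS _ mlt).
move=> /(_ measurableT [set true]) /(_ I); rewrite setTI; congr measurable.
by apply/seteqP; split => w /=; rewrite in_itv /= fset_min_ltP.
Qed.

(** The summand may depend on the sample point: the induction needs this, since
    the correction for repeated arrivals compares elements with the current
    arrival. *)
Lemma measurable_sum_memory (R : realType) d (T : measurableType d)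
    (X : nat -> T -> R) n (g : T * R -> R) :
  (forall k, (k < n)%N -> measurable_fun setT (X k)) ->
  measurable_fun setT g ->
  measurable_fun setT (fun w => \sum_(y <- memory (X ^~ w) n) g (w, y)).
Proof.
elim: n g => [|n IHn] g mX mg.
  under eq_fun do rewrite big_seq_fset1.
  exact: measurableT_comp mg (pair2_measurable _).
have {}IHn (h : T * R -> R) := IHn h (fun k kn => mX k (ltnW kn)).
have mXn := mX n (ltnSn n).
have mmin : measurable_fun setT (fun w => fset_min (memory (X ^~ w) n)).
  apply: measurable_fset_min => [w|h mh]; first exact: memory_neq0.
  exact: (IHn (fun p => h p.2) (measurableT_comp mh measurable_snd)).
under eq_fun do rewrite memory_sumS.
apply: measurable_funD; first exact: IHn.
apply: measurable_funB; first apply: measurable_funB.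
- exact: measurableT_comp mg (measurable_fun_pair _ mXn).
- apply: measurable_fun_ifT => //; first exact: measurable_fun_ltr.
  exact: measurableT_comp mg (measurable_fun_pair _ mmin).
- apply: (IHn (fun p => if p.2 == X n p.1 then g p else 0)).
  apply: measurable_fun_ifT => //; apply: measurable_fun_eqr.
    exact: measurable_snd.
  exact: measurableT_comp mXn measurable_fst.
Qed.

Section threshold_sums.
Context (R : realType).
Implicit Types (x : nat -> R) (g : R -> R).

Local Notation t := (threshold R).

Lemma above_threshold0 x : above_threshold x 0 = fset0.
Proof. by apply/fsetP => y; rewrite !inE. Qed.

Lemma above_thresholdS x n :
  above_threshold x n.+1 =
  if t <= x n then (x n |` above_threshold x n)%fset else above_threshold x n.
Proof.
apply/fsetP => y; rewrite /above_threshold -addn1 iotaD /= map_cat /=.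
rewrite !inE mem_cat inE; case: ifP => tx; rewrite !inE.
  by case: (y =P x n) => [->|_]; rewrite ?tx ?orbT ?orbF.
by case: (y =P x n) => [->|_]; rewrite ?tx ?andbF ?orbT ?orbF.
Qed.

Lemma above_threshold_sumS x n g :
  let A := above_threshold x n in
  \sum_(z <- above_threshold x n.+1) g z =
  \sum_(z <- A) g z + ((if t <= x n then g (x n) else 0) -
    \sum_(z <- A) (if z == x n then g z else 0)).
Proof.
move=> A; rewrite above_thresholdS -/A; case: ifPn => tx.
  by rewrite fset_sumU1.
rewrite fset_sum_pred1; case: ifPn; last by rewrite subrr addr0.
by rewrite !inE (negbTE tx) andbF.
Qed.

Lemma measurable_sum_above_threshold d (T : measurableType d)
    (X : nat -> T -> R) n (g : T * R -> R) :
  (forall k, (k < n)%N -> measurable_fun setT (X k)) ->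
  measurable_fun setT g ->
  measurable_fun setT (fun w => \sum_(y <- above_threshold (X ^~ w) n) g (w, y)).
Proof.
elim: n g => [|n IHn] g mX mg.
  under eq_fun do rewrite above_threshold0 big_seq_fset0.
  exact: measurable_cst.
have {}IHn (h : T * R -> R) := IHn h (fun k kn => mX k (ltnW kn)).
have mXn := mX n (ltnSn n).
under eq_fun do rewrite above_threshold_sumS.
apply: measurable_funD; first exact: IHn.
apply: measurable_funB.
- apply: measurable_fun_ifT => //; first exact: measurable_fun_ler.
  exact: measurableT_comp mg (measurable_fun_pair _ mXn).
- apply: (IHn (fun p => if p.2 == X n p.1 then g p else 0)).
  apply: measurable_fun_ifT => //; apply: measurable_fun_eqr.
    exact: measurable_snd.
  exact: measurableT_comp mXn measurable_fst.
Qed.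

End threshold_sums.

(** * Drift of the potential and of the count above the threshold *)

Section dynamics.
Context (R : realType).
Implicit Types (x : nat -> R) (y : R) (S : {fset R}).

Local Notation t := (threshold R).
Local Notation U := (uniform01_law R).

Lemma eq_memory x x' n :
  (forall k, (k < n)%N -> x k = x' k) -> memory x n = memory x' n.
Proof.
elim: n => //= n IHn xx'; rewrite IHn ?xx'// => k kn.
by apply: xx'; exact: ltnW.
Qed.

Lemma eq_above_threshold x x' n :
  (forall k, (k < n)%N -> x k = x' k) ->
  above_threshold x n = above_threshold x' n.
Proof.
elim: n => [|n IHn] xx'; first by rewrite !above_threshold0.
by rewrite !above_thresholdS IHn ?xx'// => k kn; apply: xx'; exact: ltnW.
Qed.

Lemma memory_update x n y : memory (update x n y) n = memory x n.
Proof. by apply: eq_memory => k; exact: updateE. Qed.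

Lemma above_threshold_update x n y :
  above_threshold (update x n y) n = above_threshold x n.
Proof. by apply: eq_above_threshold => k; exact: updateE. Qed.

(** A uniform arrival almost surely avoids a given finite set. *)
Lemma Rintegral_fset_null (g : R -> R) (s : seq R) :
  U.-integrable setT
    (EFin \o (fun y => \sum_(z <- s) (if z == y then g z else 0))) /\
  \int[U]_y (\sum_(z <- s) (if z == y then g z else 0)) = 0.
Proof.
have mz z : measurable [set y : R | z == y].
  rewrite (_ : [set y | z == y] = [set z]); first exact: measurable_set1.
  by apply/seteqP; split => y /= => [/eqP|->].
have iz z : U.-integrable setT (EFin \o (fun y => if z == y then g z else 0)).
  apply: (@bounded_integrable _ _ _ _ _ `|g z|) => [|y].
    by apply: measurable_fun_ifT => //; exact: measurable_fun_eqr.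
  by case: ifP => //; rewrite normr0.
elim: s => [|z s [is0 s0]].
  have -> : (fun y => \sum_(z <- [::]) (if z == y then g z else 0)) = cst 0.
    by apply/funext => y; rewrite big_nil.
  split; last by rewrite Rintegral_cst// mul0r.
  by apply: (@bounded_integrable _ _ _ _ _ 0) => [|y]; rewrite ?normr0.
have -> : (fun y => \sum_(i <- z :: s) (if i == y then g i else 0)) =
    fun y => (if z == y then g z else 0) +
             \sum_(i <- s) (if i == y then g i else 0).
  by apply/funext => y; rewrite big_cons.
split; first exact: (integrableD measurableT (iz z) is0).
rewrite RintegralD// s0 addr0 Rintegral_if//.
have -> : [set y | z == y] = [set z].
  by apply/seteqP; split => y /= => [/eqP|->].
by rewrite uniform01_law_set1 mulr0.
Qed.

Definition potential n x : R := \sum_(y <- memory x n) weight y.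

(** The idle steps are the only ones at which an element above the threshold can
    be removed. *)
Definition idle n x : R := if t <= fset_min (memory x n) then 1 else 0.

Lemma potential_ge0 n x : 0 <= potential n x.
Proof. by apply: sumr_ge0 => y _; exact: weight_ge0. Qed.

(** The gain and the loss of one step both lie between [0] and the largest
    weight. *)
Lemma potential_incr_le n x : `|potential n.+1 x - potential n x| <= expR 1.
Proof.
rewrite /potential memory_sumS addrAC subrr add0r fset_sum_pred1.
set a := (if _ < _ then _ else _); set b := (if _ \in _ then _ else _).
have a0 : 0 <= a <= expR 1.
  by rewrite /a; case: ifP; rewrite ?weight_ge0 ?le_weight ?lexx ?expR_ge0.
have b0 : 0 <= weight (x n) - b <= expR 1.
  rewrite /b; case: ifP => _; first by rewrite subrr lexx expR_ge0.
  by rewrite subr0 weight_ge0 le_weight.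
rewrite ler_norml; lra.
Qed.

(** This orthogonality is what makes the potential behave, as far as second
    moments are concerned, like a martingale. *)
Lemma potential_idle n x : potential n x * idle n x = 0.
Proof.
rewrite /idle /potential; case: ifP; rewrite ?mulr0// mulr1 => tm.
rewrite big_seq big1// => y /fset_min_le /(le_trans tm).
by rewrite /weight leNgt => /negbTE ->.
Qed.

(** The expected gain is [1] by [Rintegral_weight], and the expected loss at the
    minimum [m] is [weight m] times the probability of exceeding [m]: it is [1]
    if [m] is below the threshold, and [0] otherwise. *)
Lemma potential_drift n x :
  \int[U]_y (potential n.+1 (update x n y) - potential n x) = idle n x.
Proof.
set S := memory x n; set m := fset_min S.
have [iS S0] := Rintegral_fset_null (@weight R) S.
have mm : measurable [set y : R | m < y].
  rewrite (_ : [set y | m < y] = `]m, +oo[%classic) //.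
  by apply/seteqP; split => y /=; rewrite in_itv/= andbT.
have im : U.-integrable setT (EFin \o (fun y => if m < y then weight m else 0)).
  apply: (@bounded_integrable _ _ _ _ _ `|weight m|) => [|y].
    by apply: measurable_fun_ifT => //; exact: measurable_fun_ltr.
  by case: ifP => //; rewrite normr0.
have iw : U.-integrable setT (EFin \o @weight R).
  apply: (@bounded_integrable _ _ _ _ _ (expR 1)) => [|y].
    exact: measurable_weight.
  by rewrite ger0_norm ?weight_ge0// le_weight.
transitivity (\int[U]_y (weight y - (if m < y then weight m else 0) -
    \sum_(z <- S) (if z == y then weight z else 0))).
  apply: eq_Rintegral => y _.
  by rewrite /potential memory_sumS memory_update update_same addrAC subrr add0r.
rewrite RintegralB//; last exact: (integrableB measurableT iw im).
rewrite S0 subr0 RintegralB// Rintegral_weight Rintegral_if//.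
rewrite /idle -/S -/m /weight; case: ltP => mt; last by rewrite mul0r subr0.
rewrite (_ : [set y | m < y] = `]m, +oo[%classic); last first.
  by apply/seteqP; split => y /=; rewrite in_itv/= andbT.
have m1 := lt_trans mt (threshold_lt1 R).
rewrite uniform01_law_ray//= mulVf ?subrr// subr_eq0 gt_eqF//.
by rewrite gt_max m1 ltr01.
Qed.

(** Centred so that its drift vanishes: a uniform arrival reaches the threshold
    with probability [1 / e]. *)
Definition excess n x : R := #|` above_threshold x n|%:R - n%:R / expR 1.

Lemma excess_incr n x : let A := above_threshold x n in
  excess n.+1 x - excess n x =
  (if t <= x n then 1 else 0) -
  \sum_(z <- A) (if z == x n then 1 else 0) - (expR 1)^-1.
Proof.
move=> A; rewrite /excess -!fset_sum1 above_threshold_sumS -/A -natr1.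
rewrite -/(threshold R) mulrDl mul1r.
set a := \sum_(z <- A) 1; set b := \sum_(z <- A) _; set c := (if _ then _ else _).
by ring.
Qed.

Lemma excess_incr_le n x : `|excess n.+1 x - excess n x| <= 1.
Proof.
rewrite excess_incr fset_sum_pred1.
have := expR1_gt0 R; have := expR1_lt1 R.
set A := above_threshold x n.
have : x n \in A -> t <= x n by rewrite !inE => /andP[].
case: (x n \in A) => [/(_ isT) ->|_]; last case: ifP => _;
rewrite ler_norml; lra.
Qed.

Lemma excess_drift n x :
  \int[U]_y (excess n.+1 (update x n y) - excess n x) = 0.
Proof.
set A := above_threshold x n.
have [iA A0] := Rintegral_fset_null (fun=> 1) A.
have it : U.-integrable setT (EFin \o (fun y => if t <= y then 1 else 0)).
  apply: (@bounded_integrable _ _ _ _ _ 1) => [|y].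
    by apply: measurable_fun_ifT => //; exact: measurable_fun_ler.
  by case: ifP => //; rewrite ?normr0 ?normr1.
have ie : U.-integrable setT (EFin \o (fun=> (expR 1)^-1)).
  exact: (@bounded_integrable _ _ _ _ _ `|(expR 1)^-1|).
transitivity (\int[U]_y ((if t <= y then 1 else 0) -
  \sum_(z <- A) (if z == y then 1 else 0) - (expR 1)^-1)).
  apply: eq_Rintegral => y _.
  have := excess_incr n (update x n y).
  rewrite /= above_threshold_update update_same => <-.
  by congr (_ - _); rewrite /excess above_threshold_update.
rewrite RintegralB//; last exact: (integrableB measurableT it iA).
rewrite Rintegral_cst//= probability_setT mulr1 RintegralB// A0 subr0.
have st : [set y | t <= y] = `[t, +oo[%classic.
  by apply/seteqP; split => y /=; rewrite in_itv/= andbT.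
rewrite Rintegral_if st//.
rewrite uniform01_law_ray ?threshold_lt1//= mul1r max_l ?ltW ?threshold_gt0//.
by rewrite /threshold subKr subrr.
Qed.

End dynamics.

(** * Bounding the symmetric difference *)

Section combinatorics.
Context (R : realType).
Implicit Types (x : nat -> R) (y : R).
Local Notation t := (threshold R).

Lemma memory_above_threshold x n y :
  y \in memory x n -> t <= y -> y \in above_threshold x n.
Proof.
elim: n => [|n IHn] /= yS ty.
  by move: yS ty; rewrite !inE => /eqP ->; rewrite leNgt threshold_gt0.
rewrite above_thresholdS.
have {}yS : y \in (x n |` memory x n)%fset.
  by move: yS; case: ifP => // _; rewrite inE => /andP[].
move: yS; rewrite in_fset1U => /predU1P[yx|/IHn/(_ ty) yA].
  by rewrite -yx ty in_fset1U eqxx.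
by case: ifP => // _; rewrite in_fset1U yA orbT.
Qed.

Definition idle_count n x : R := \sum_(k < n) idle k x.

Lemma idle_countS n x : idle_count n.+1 x = idle_count n x + idle n x.
Proof. by rewrite /idle_count big_ord_recr. Qed.

(** An element of the memory that is not among the arrivals above the threshold
    lies below it, and so has weight at least [1]. *)
Lemma memory_below_le n x :
  #|` (memory x n `\` above_threshold x n)%fset|%:R <= potential n x.
Proof.
set S := memory x n; set A := above_threshold x n.
have SA : [fset y in S | ~~ (y \in A)]%fset = (S `\` A)%fset.
  by apply/fsetP => y; rewrite !inE andbC.
rewrite -fset_sum1 /potential -/S (big_fsetID _ (mem A) S)/= SA.
rewrite ler_wpDl ?sumr_ge0// => [y _|]; first exact: weight_ge0.
rewrite big_seq [leRHS]big_seq; apply: ler_sum => y.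
rewrite in_fsetD => /andP[yA yS]; apply: weight_ge1; rewrite ltNge.
by apply: contra yA; exact: memory_above_threshold.
Qed.

(** An arrival above the threshold leaves the memory only as its minimum; at
    that step all of the memory is above the threshold, and one element at most
    is lost. *)
Lemma above_forgotten_le n x :
  #|` (above_threshold x n `\` memory x n)%fset|%:R <= idle_count n x.
Proof.
elim: n => [|n IHn].
  by rewrite above_threshold0 fset0D cardfs0 /idle_count big_ord0.
rewrite idle_countS.
set A := above_threshold x n in IHn *; set S := memory x n in IHn *.
set m := fset_min S.
have sub y : y \in (above_threshold x n.+1 `\` memory x n.+1)%fset ->
    y \in (A `\` S)%fset \/ (t <= m /\ y = m).
  rewrite in_fsetD => /andP[yS' yA'].
  have ty : t <= y by move: yA'; rewrite !inE => /andP[].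
  have [yS|yS] := boolP (y \in S).
    right; move: yS'; rewrite /= -/S -/m; case: ifP => mx; last first.
      by rewrite in_fset1U yS orbT.
    by rewrite in_fsetD1 in_fset1U yS orbT andbT negbK => /eqP <-.
  left; rewrite in_fsetD yS /=; move: yA'; rewrite above_thresholdS -/A.
  case: ifP => // _; rewrite in_fset1U => /predU1P[yx|//].
  move: yS'; rewrite /= -/S -/m; case: ifP => mx.
    by rewrite in_fsetD1 in_fset1U yx eqxx gt_eqF.
  by rewrite in_fset1U yx eqxx.
rewrite /idle -/S -/m; case: (boolP (t <= m)) => tm.
  have /fsubset_leq_card : (above_threshold x n.+1 `\` memory x n.+1 `<=`
      m |` (A `\` S))%fset.
    by apply/fsubsetP => y /sub; rewrite in_fset1U => -[->|[_ ->]];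
      rewrite ?eqxx ?orbT.
  rewrite -(ler_nat R) => h; apply: le_trans h _.
  by rewrite cardfsU1 natrD addrC lerD// lern1 leq_b1.
rewrite addr0; apply: le_trans IHn; rewrite ler_nat; apply: fsubset_leq_card.
by apply/fsubsetP => y /sub [//|[]]; rewrite (negbTE tm).
Qed.

Lemma card_symdiff n x :
  #|` fset_symdiff (memory x n) (above_threshold x n)|%:R
  <= potential n x + idle_count n x.
Proof.
apply: le_trans (lerD (memory_below_le n x) (above_forgotten_le n x)).
rewrite -natrD ler_nat /fset_symdiff cardfsU; exact: leq_subr.
Qed.

Lemma card_fset_symdiff (K : choiceType) (S A : {fset K}) :
  #|` fset_symdiff S A| = (#|` (S `\` A)%fset| + #|` (A `\` S)%fset|)%N.
Proof.
rewrite /fset_symdiff cardfsU [X in (_ - X)%N](_ : _ = 0%N) ?subn0//.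
apply/eqP; rewrite cardfs_eq0; apply/eqP/fsetP => y; rewrite !inE.
by case: (y \in S); rewrite ?andbF.
Qed.

Lemma card_diff_symdiff (K : choiceType) (S A : {fset K}) :
  `| #|` S|%:R - #|` A|%:R | <= #|` fset_symdiff S A|%:R :> R.
Proof.
rewrite card_fset_symdiff.
rewrite -(cardfsID A S) -(cardfsID S A) [(A `&` S)%fset]fsetIC !natrD.
set a : R := _%:R; set b : R := _%:R; set c : R := _%:R.
have : 0 <= a by [].
have : 0 <= b by [].
by rewrite ler_norml; lra.
Qed.

(** The size of the memory is compared with [n / e] through the number of
    distinct arrivals above the threshold. *)
Lemma card_memory_deviation n x :
  `| #|` memory x n|%:R - n%:R / expR 1| <=
  potential n x + idle_count n x + `|excess n x|.
Proof.
have := card_diff_symdiff (memory x n) (above_threshold x n).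
have := card_symdiff n x; rewrite /excess.
set s : R := #|` fset_symdiff _ _|%:R => h1 h2.
apply: le_trans (lerD (le_trans h2 h1) (lexx _)).
by apply: le_trans (ler_normD _ _); rewrite addrA subrK.
Qed.

End combinatorics.

(** * Measurability of the observed quantities *)

Section adaptedness.
Context (R : realType).

Lemma adapted_potential n : adapted n (@potential R n).
Proof.
move=> d T X mX; apply: (measurable_sum_memory (g := fun p => weight p.2)) => //.
exact: measurableT_comp (@measurable_weight R) measurable_snd.
Qed.

Lemma adapted_idle n : adapted n (@idle R n).
Proof.
move=> d T X mX; apply: measurable_fun_ifT => //.
apply: measurable_fun_ler => //; apply: measurable_fset_min => [w|g mg].
  exact: memory_neq0.
apply: (measurable_sum_memory (g := fun p => g p.2)) => //.
exact: measurableT_comp mg measurable_snd.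
Qed.

Lemma adapted_idle_count n : adapted n (@idle_count R n).
Proof.
move=> d T X mX; apply: measurable_sum => k; apply: adapted_idle => j jk.
by apply: mX; exact: ltn_trans jk (ltn_ord k).
Qed.

Lemma adapted_excess n : adapted n (@excess R n).
Proof.
move=> d T X mX; apply: measurable_funB => //.
under eq_fun do rewrite -fset_sum1.
exact: (measurable_sum_above_threshold (g := fun=> 1)).
Qed.

Lemma adapted_card_memory n :
  adapted n (fun x : nat -> R => #|` memory x n|%:R).
Proof.
move=> d T X mX; under eq_fun do rewrite -fset_sum1.
exact: (measurable_sum_memory (g := fun=> 1)).
Qed.

(** Membership is written as a sum of point indicators, which brings the size of
    the symmetric difference within reach of the measurability of sums. *)
Lemma fset_symdiff_sumE (S A : {fset R}) :
  #|` fset_symdiff S A|%:R =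
  \sum_(y <- S) (1 - \sum_(z <- A) (if z == y then 1 else 0)) +
  \sum_(y <- A) (1 - \sum_(z <- S) (if z == y then 1 else 0)) :> R.
Proof.
have cardD (B C : {fset R}) : #|` (B `\` C)%fset|%:R =
    \sum_(y <- B) (1 - \sum_(z <- C) (if z == y then 1 else 0)) :> R.
  rewrite -fset_sum1.
  have BC : (B `\` C `<=` B)%fset by exact: fsubsetDl.
  rewrite -(big_fset_incl _ BC) /= => [|y yB].
    rewrite big_seq [RHS]big_seq; apply: eq_bigr => y; rewrite in_fsetD.
    by rewrite fset_sum_pred1 => /andP[/negbTE -> _]; rewrite subr0.
  by rewrite in_fsetD yB andbT negbK fset_sum_pred1 => ->; rewrite subrr.
by rewrite -!cardD card_fset_symdiff natrD.
Qed.

Lemma adapted_card_symdiff n :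
  adapted n (fun x : nat -> R =>
    #|` fset_symdiff (memory x n) (above_threshold x n)|%:R).
Proof.
move=> d T X mX; under eq_fun do rewrite fset_symdiff_sumE.
have mX' k : (k < n)%N -> measurable_fun setT (fun p : T * R => X k p.1).
  by move=> kn; exact: measurableT_comp (mX k kn) measurable_fst.
have mpt : measurable_fun setT
    (fun p : (T * R) * R => if p.2 == p.1.2 then 1 else 0 : R).
  apply: measurable_fun_ifT => //; apply: measurable_fun_eqr.
    exact: measurable_snd.
  exact: measurableT_comp measurable_snd measurable_fst.
apply: measurable_funD.
- apply: (measurable_sum_memory (g := fun p : T * R =>
    1 - \sum_(z <- above_threshold (X ^~ p.1) n) (if z == p.2 then 1 else 0))) => //.
  apply: measurable_funB => //.
  exact: (measurable_sum_above_threshold mX' mpt).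
- apply: (measurable_sum_above_threshold (g := fun p : T * R =>
    1 - \sum_(z <- memory (X ^~ p.1) n) (if z == p.2 then 1 else 0))) => //.
  apply: measurable_funB => //.
  exact: (measurable_sum_memory mX' mpt).
Qed.

End adaptedness.

(** * Moments of processes with controlled drift *)

Section moments.
Context (d : measure_display) (T : measurableType d) (R : realType).
Context (P : probability T R) (X : nat -> {RV P >-> R}).
Context (Xindep : mutually_independent X) (Xunif : forall k, uniform01 (X k)).

Local Notation U := (uniform01_law R).
Local Notation E f := (\int[P]_w f (X ^~ w)).

Lemma measurable_adapted n f :
  adapted n f -> measurable_fun setT (fun w => f (X ^~ w)).
Proof. by move=> fad; apply: fad => k _; exact: measurable_funP. Qed.

Lemma integrable_adapted n f M : adapted n f -> (forall x, `|f x| <= M) ->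
  P.-integrable setT (EFin \o (fun w => f (X ^~ w))).
Proof.
move=> fad fM; apply: (@bounded_integrable _ _ _ _ _ M) => //.
exact: measurable_adapted fad.
Qed.

Lemma measurable_update m n f (x : nat -> R) :
  adapted m f -> measurable_fun setT (fun y => f (update x n y)).
Proof.
move=> fad; apply: (fad _ R (fun k y => update x n y k)) => k _.
by rewrite /update; case: (k == n).
Qed.

Section process.
Context (V : nat -> (nat -> R) -> R) (v0 M : R).
Context (Vad : forall n, adapted n (V n)) (V0 : forall x, V 0 x = v0).
Context (VM : forall n x, `|V n.+1 x - V n x| <= M).
Context (Vup : forall n x y, V n (update x n y) = V n x).

Let D n x := V n.+1 x - V n x.

Lemma process_bounded n x : `|V n x| <= `|v0| + n%:R * M.
Proof.
elim: n => [|n IHn]; first by rewrite V0 mul0r addr0.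
rewrite -natr1 mulrDl mul1r addrA -[V n.+1 x](subrK (V n x)) addrC.
by apply: le_trans (ler_normD _ _) _; rewrite lerD.
Qed.

Let Dad n : adapted n.+1 (D n).
Proof.
move=> d' T' X' mX'; apply: measurable_funB; first exact: Vad.
exact: (adaptedS (@Vad n)).
Qed.

Lemma Rintegral_incr n (b : (nat -> R) -> R) :
  (forall x, \int[U]_y (V n.+1 (update x n y) - V n x) = b x) ->
  E (V n.+1) = E (V n) + E b.
Proof.
move=> Vb; have iD := integrable_adapted (@Dad n) (VM n).
have iV := integrable_adapted (@Vad n) (process_bounded n).
have -> : E b = E (D n).
  rewrite (Rintegral_update Xindep Xunif (@Dad n) (VM n)).
  apply: eq_Rintegral => w _; rewrite -Vb; apply: eq_Rintegral => y _.
  by rewrite /D Vup.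
rewrite -RintegralD//; apply: eq_Rintegral => w _.
by rewrite /D addrC subrK.
Qed.

(** Expanding [(V + D)^2], the cross term has zero expectation by
    [Rintegral_update], because [V] depends on the past only and is orthogonal
    to the drift.  It remains to add up the squares of the increments. *)
Lemma second_moment n :
  (forall k x, V k x * \int[U]_y (V k.+1 (update x k y) - V k x) = 0) ->
  E (fun x => V n x ^+ 2) <= v0 ^+ 2 + n%:R * M ^+ 2.
Proof.
move=> Vdrift; elim: n => [|n IHn].
  under eq_Rintegral do rewrite V0.
  by rewrite Rintegral_cst//= probability_setT mulr1 mul0r addr0.
have M0 : 0 <= M by exact: le_trans (VM 0 (fun=> 0)).
pose B := `|v0| + n%:R * M.
have B0 : 0 <= B by rewrite addr_ge0// mulr_ge0.
have VDad : adapted n.+1 (fun x => V n x * D n x).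
  move=> d' T' X' mX'; apply: measurable_funM; last exact: Dad.
  exact: (adaptedS (@Vad n)).
have VDB x : `|V n x * D n x| <= B * M.
  by rewrite normrM; apply: ler_pM; rewrite ?process_bounded//; exact: VM.
have V2ad : adapted n (fun x => V n x ^+ 2).
  by move=> d' T' X' mX'; apply: measurable_funX; exact: Vad.
have V2B x : `|V n x ^+ 2| <= B ^+ 2.
  by rewrite normrX lerXn2r// ?nnegrE// process_bounded.
have D2ad : adapted n.+1 (fun x => D n x ^+ 2).
  by move=> d' T' X' mX'; apply: measurable_funX; exact: Dad.
have D2B x : `|D n x ^+ 2| <= M ^+ 2.
  by rewrite normrX lerXn2r// ?nnegrE//; exact: VM.
have iVD := integrable_adapted VDad VDB.
have iV2 := integrable_adapted V2ad V2B.
have iD2 := integrable_adapted D2ad D2B.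
have VD0 : E (fun x => V n x * D n x) = 0.
  rewrite (Rintegral_update Xindep Xunif VDad VDB).
  rewrite (_ : \int[P]_w _ = \int[P]_w 0); first by rewrite Rintegral_cst// mul0r.
  apply: eq_Rintegral => w _; rewrite -[RHS](Vdrift n (X ^~ w)).
  rewrite -RintegralZl//.
    by apply: eq_Rintegral => y _; rewrite /D Vup.
  apply: (@bounded_integrable _ _ _ _ _ M) => [|y].
    apply: measurable_funB => //; exact: measurable_update (@Vad n.+1).
  by have := VM n (update (X ^~ w) n y); rewrite Vup.
rewrite -natr1 mulrDl mul1r addrA.
have ED2 : E (fun x => D n x ^+ 2) <= M ^+ 2.
  apply: le_trans (ler_norm _) _; apply: Rintegral_bounded => [|w].
    exact: measurable_adapted D2ad.
  exact: D2B.
apply: le_trans (lerD IHn ED2).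
rewrite le_eqVlt; apply/orP; left; apply/eqP.
transitivity (E (fun x => V n x ^+ 2) + E (fun x => V n x * D n x) *+ 2 +
   E (fun x => D n x ^+ 2)); last by rewrite VD0 mul0rn addr0.
rewrite mulr2n addrA -!RintegralD//.
- apply: eq_Rintegral => w _; rewrite /D; ring.
- exact: (integrableD measurableT (integrableD measurableT iV2 iVD) iVD).
- exact: (integrableD measurableT iV2 iVD).
Qed.

(** The inequality [2 s |v| <= v^2 + s^2], integrated for [s = sqrt n], replaces
    the Cauchy-Schwarz inequality. *)
Lemma first_abs_moment n a : (0 < n)%N ->
  E (fun x => V n x ^+ 2) <= a * n%:R ->
  E (fun x => `|V n x|) <= (a + 1) / 2 * Num.sqrt n%:R.
Proof.
move=> n0 V2; set s := Num.sqrt n%:R.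
have s0 : 0 < s by rewrite sqrtr_gt0 ltr0n.
have s2 : s ^+ 2 = n%:R by rewrite sqr_sqrtr.
pose B := `|v0| + n%:R * M.
have V2ad : adapted n (fun x => V n x ^+ 2).
  by move=> d' T' X' mX'; apply: measurable_funX; exact: Vad.
have B0 : 0 <= B := le_trans (normr_ge0 _) (process_bounded n (fun=> 0)).
have V2B x : `|V n x ^+ 2| <= B ^+ 2.
  by rewrite normrX lerXn2r// ?nnegrE// process_bounded.
have iV2 := integrable_adapted V2ad V2B.
have iV2s : P.-integrable setT (EFin \o (fun w => (2 * s)^-1 * V n (X ^~ w) ^+ 2)).
  exact: (integrableZl measurableT _ iV2).
have ic : P.-integrable setT (EFin \o (cst (s / 2) : T -> R)).
  exact: (@bounded_integrable _ _ _ _ _ `|s / 2|).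
apply: (@le_trans _ _
    (\int[P]_w ((2 * s)^-1 * V n (X ^~ w) ^+ 2 + s / 2))).
  apply: le_Rintegral => //.
  - apply: (@bounded_integrable _ _ _ _ _ B) => [|w].
      by apply: measurableT_comp => //; exact: measurable_adapted (@Vad n).
    by rewrite normr_id process_bounded.
  - exact: (integrableD measurableT iV2s ic).
  - move=> w _; set v := V n _.
    rewrite -(ler_pM2l (_ : 0 < 2 * s)) ?mulr_gt0// mulrDr mulVKf ?gt_eqF ?mulr_gt0//.
    have : 0 <= (`|v| - s) ^+ 2 by exact: sqr_ge0.
    by rewrite -[v ^+ 2]real_normK ?num_real//; nra.
rewrite RintegralD// RintegralZl// Rintegral_cst//= probability_setT mulr1.
have : (2 * s)^-1 * E (fun x => V n x ^+ 2) <= (2 * s)^-1 * (a * n%:R).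
  by rewrite ler_pM2l// invr_gt0 mulr_gt0.
rewrite -s2 (_ : _ * (a * s ^+ 2) = a / 2 * s); first lra.
by field; rewrite gt_eqF.
Qed.

End process.
End moments.

(** * Expectations for the memory process, and the theorem *)

Section estimates.
Context (d : measure_display) (T : measurableType d) (R : realType).
Context (P : probability T R) (X : nat -> {RV P >-> R}).
Context (Xindep : mutually_independent X) (Xunif : forall k, uniform01 (X k)).

Local Notation e := (expR 1 : R).
Local Notation E f := (\int[P]_w f (X ^~ w)).

Lemma potential0 x : @potential R 0 x = 1.
Proof.
rewrite /potential big_seq_fset1 /weight threshold_gt0.
by rewrite max_l// subr0 invr1.
Qed.

Lemma potential_update n (x : nat -> R) y :
  potential n (update x n y) = potential n x.
Proof. by rewrite /potential memory_update. Qed.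

Lemma excess0 x : @excess R 0 x = 0.
Proof. by rewrite /excess above_threshold0 cardfs0 mul0r subrr. Qed.

Lemma excess_update n (x : nat -> R) y : excess n (update x n y) = excess n x.
Proof. by rewrite /excess above_threshold_update. Qed.

Lemma idle_count_bounded n (x : nat -> R) : 0 <= idle_count n x <= n%:R.
Proof.
have i01 k : 0 <= idle k x <= 1 by rewrite /idle; case: ifP; rewrite ?lexx ?ler01.
rewrite sumr_ge0/= => [|k _]; last by have /andP[] := i01 k.
rewrite -[n in leRHS]card_ord -sumr_const; apply: ler_sum => k _.
by have /andP[] := i01 k.
Qed.

Let potential_bounded n x : `|potential n x| <= `|1 : R| + n%:R * e.
Proof. exact: (process_bounded potential0 (@potential_incr_le R)). Qed.

Let excess_bounded n x : `|excess n x| <= `|0 : R| + n%:R * 1.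
Proof. exact: (process_bounded excess0 (@excess_incr_le R)). Qed.

Let integrable_potential n : P.-integrable setT (EFin \o (fun w => potential n (X ^~ w))).
Proof. exact: integrable_adapted (@adapted_potential R n) (potential_bounded n). Qed.

Let integrable_idle_count n :
  P.-integrable setT (EFin \o (fun w => idle_count n (X ^~ w))).
Proof.
apply: integrable_adapted (@adapted_idle_count R n) _ => x.
by have /andP[i0 i1] := idle_count_bounded n x; rewrite ger0_norm//; exact: i1.
Qed.

Lemma expectation_potential n : (0 < n)%N ->
  E (potential n) <= (2 + e ^+ 2) / 2 * Num.sqrt n%:R.
Proof.
move=> n0.
have := second_moment Xindep Xunif (@adapted_potential R) potential0
  (@potential_incr_le R) potential_update n.
rewrite expr1n => /(_ _)/wrap[k x|V2].
  by rewrite potential_drift potential_idle.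
have {}V2 : E (fun x => potential n x ^+ 2) <= (1 + e ^+ 2) * n%:R.
  apply: le_trans V2 _; rewrite mulrDl mul1r mulrC lerD2r.
  by rewrite ler1n.
have := first_abs_moment (@adapted_potential R) potential0
  (@potential_incr_le R) n0 V2.
rewrite (_ : 1 + e ^+ 2 + 1 = 2 + e ^+ 2); last by ring.
by under eq_Rintegral do rewrite ger0_norm ?potential_ge0//.
Qed.

(** The idle count is the compensator of the potential, which starts from [1],
    the weight of the seed [0]. *)
Lemma expectation_idle_count n : E (idle_count n) = E (potential n) - 1.
Proof.
elim: n => [|n IHn].
  under eq_Rintegral do rewrite /idle_count big_ord0.
  under [in RHS]eq_Rintegral do rewrite potential0.
  by rewrite !Rintegral_cst//= probability_setT mul0r mulr1 subrr.
rewrite (Rintegral_incr Xindep Xunif (@adapted_potential R) potential0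
  (@potential_incr_le R) potential_update (@potential_drift R n)).
under eq_Rintegral do rewrite idle_countS.
rewrite RintegralD// ?IHn; first by ring.
have i1 x : `|@idle R n x| <= 1 by rewrite /idle; case: ifP; rewrite ?normr0 ?normr1.
exact: integrable_adapted (@adapted_idle R n) i1.
Qed.

Lemma expectation_abs_excess n : (0 < n)%N ->
  E (fun x => `|excess n x|) <= Num.sqrt n%:R.
Proof.
move=> n0.
have := second_moment Xindep Xunif (@adapted_excess R) excess0
  (@excess_incr_le R) excess_update n.
move=> /(_ _)/wrap[k x|V2]; first by rewrite excess_drift mulr0.
have {}V2 : E (fun x => excess n x ^+ 2) <= 1 * n%:R.
  by apply: le_trans V2 _; rewrite expr0n/= add0r expr1n mulr1 mul1r.
have := first_abs_moment (@adapted_excess R) excess0 (@excess_incr_le R) n0 V2.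
by rewrite divff ?mul1r.
Qed.

Lemma expectation_symdiff_bound n : (0 < n)%N ->
  E (fun x => potential n x + idle_count n x) <= (2 + e ^+ 2) * Num.sqrt n%:R.
Proof.
move=> n0; rewrite RintegralD// expectation_idle_count.
by have := expectation_potential n0; lra.
Qed.

Lemma expectation_size_bound n : (0 < n)%N ->
  E (fun x => potential n x + idle_count n x + `|excess n x|) <=
  (3 + e ^+ 2) * Num.sqrt n%:R.
Proof.
move=> n0; rewrite RintegralD//.
- by have := expectation_symdiff_bound n0; have := expectation_abs_excess n0; lra.
- exact: (integrableD measurableT (integrable_potential n) (integrable_idle_count n)).
- apply: (@bounded_integrable _ _ _ _ _ (`|0 : R| + n%:R * 1)) => [|w].
    apply: measurableT_comp => //.
    exact: measurable_adapted (@adapted_excess R n).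
  by rewrite normr_id; exact: excess_bounded.
Qed.

Lemma majorant_bounded n : exists M, forall x : nat -> R,
  `|potential n x + idle_count n x + `|excess n x| | <= M.
Proof.
exists (`|1 : R| + n%:R * e + n%:R + (`|0 : R| + n%:R * 1)) => x.
have /andP[i0 i1] := idle_count_bounded n x.
rewrite ger0_norm ?addr_ge0 ?potential_ge0//.
rewrite !lerD//.
by apply: le_trans (potential_bounded n x); exact: ler_norm.
Qed.

End estimates.

(** The event is measured through the observable [Q], while Markov's inequality
    is applied to a majorant [B] whose expectation is known. *)
Lemma markov_whp d (T : measurableType d) (R : realType) (P : probability T R)
    (Q B : nat -> T -> R) (r : nat -> R) (K : R) :
  (forall n, measurable_fun setT (Q n)) ->
  (forall n, measurable_fun setT (B n)) ->
  (forall n w, Q n w <= B n w) -> (forall n w, 0 <= B n w) ->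
  (forall n, exists M, forall w, `|B n w| <= M) ->
  (forall n, (0 < n)%N -> \int[P]_w B n w <= K * Num.sqrt n%:R) ->
  r n @[n --> \oo] --> +oo ->
  P [set w | Q n w <= r n * Num.sqrt n%:R] @[n --> \oo] --> 1%E.
Proof.
move=> mQ mB QB B0 bB EB roo.
have mle (f : T -> R) c : measurable_fun setT f -> measurable [set w | f w <= c].
  move=> mf; rewrite -[X in measurable X]setTI.
  by have := measurable_fun_ler mf (measurable_cst c) measurableT; move=> /(_ [set true]); apply.
have bnd : \forall n \near \oo,
    ((1 - K / r n)%:E <= P [set w | Q n w <= r n * Num.sqrt n%:R]%R <= 1)%E.
  near=> n.
  have n0 : (0 < n)%N by near: n; exact: nbhs_infty_gt.
  have rn0 : 0 < r n by near: n; exact: (cvgry_gt roo).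
  have s0 : 0 < Num.sqrt n%:R :> R by rewrite sqrtr_gt0 ltr0n.
  have a0 : 0 < r n * Num.sqrt n%:R by exact: mulr_gt0.
  set a := r n * Num.sqrt n%:R in a0 *.
  apply/andP; split; last by apply: probability_le1; exact: mle.
  apply: (@le_trans _ _ (P [set w | B n w <= a])).
    have [M BM] := bB n.
    have mBa := mle _ a (mB n).
    have mBaC : measurable [set w | ~~ (B n w <= a)].
      rewrite (_ : [set w | _] = ~` [set w | B n w <= a]); first exact: measurableC.
      by apply/seteqP; split => w /= /negP.
    rewrite -[X in (_ <= P X)%E]setCK probability_setC//; last exact: measurableC.
    rewrite (_ : ~` [set w | B n w <= a] = [set w | ~~ (B n w <= a)]); last first.
      by apply/seteqP; split => w /= /negP.
    rewrite -[X in (1 - X)%E]fineK ?fin_num_measure// -EFinB lee_fin lerD2l lerN2.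
    have : \int[P]_w (if ~~ (B n w <= a) then a else 0) <= K * Num.sqrt n%:R.
      apply: le_trans (EB n n0); apply: le_Rintegral => //.
      - apply: (@bounded_integrable _ _ _ _ _ a) => [|w].
          apply: measurable_fun_ifT => //.
          by apply: measurable_neg; exact: measurable_fun_ler.
        by case: ifP => _; [rewrite gtr0_norm|rewrite normr0 ltW].
      - exact: bounded_integrable BM.
      - by move=> w _; case: ifPn => //; rewrite -ltNge => /ltW.
    rewrite Rintegral_if// mulrC -ler_pdivlMr// => /le_trans; apply.
    by rewrite /a invfM mulrACA divff ?gt_eqF// mulr1.
  apply: le_measure; rewrite ?inE; [exact: mle|exact: mle|].
  by move=> w /=; exact: le_trans.
apply: (squeeze_cvge bnd); last exact: cvg_cst.
apply/cvg_EFin; first exact: nearW.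
have V0 : (r n)^-1 @[n --> \oo] --> (0 : R).
  by apply/gtr0_cvgV0 => //; exact: (cvgry_gt roo).
have : (1 - K / r n) @[n --> \oo] --> 1 - K * 0.
  by apply: cvgB; [exact: cvg_cst | apply: cvgM => //; exact: cvg_cst].
by rewrite mulr0 subr0.
Unshelve. all: by end_near.
Qed.

Theorem theorem1 (d : measure_display) (T : measurableType d) (R : realType)
    (P : probability T R) (X : nat -> {RV P >-> R})
    (Xindep : mutually_independent X) (Xunif : forall k, uniform01 (X k)) :
  (forall delta : R, 0 < delta ->
    P [set w | `| #|` memory (fun k => X k w) n |%:R - n%:R / expR 1 |
               <= delta * n%:R ] @[n --> \oo] --> 1%E)
  /\
  (exists2 C : R, 0 < C &
    P [set w | #|` fset_symdiff (memory (fun k => X k w) n)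
                                (above_threshold (fun k => X k w) n) |%:R
               <= C * (ln n%:R) `^ C * Num.sqrt n%:R ] @[n --> \oo] --> 1%E).
Proof.
have mpi n : measurable_fun setT
    (fun w => potential n (X ^~ w) + idle_count n (X ^~ w)).
  apply: measurable_funD.
    exact: measurable_adapted (@adapted_potential R n).
  exact: measurable_adapted (@adapted_idle_count R n).
have pi0 n x : 0 <= potential n x + idle_count n x :> R.
  by rewrite addr_ge0 ?potential_ge0//; have /andP[] := idle_count_bounded n x.
split=> [delta delta0|].
- have sqrtE n : delta * n%:R = delta * Num.sqrt n%:R * Num.sqrt n%:R.
    by rewrite -mulrA -expr2 sqr_sqrtr.
  under eq_fun do under eq_set do rewrite sqrtE.
  apply: (markov_whp (B := fun n w => potential n (X ^~ w) +
      idle_count n (X ^~ w) + `|excess n (X ^~ w)|) (K := 3 + expR 1 ^+ 2)).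
  + move=> n; apply: measurableT_comp => //; apply: measurable_funB => //.
    exact: measurable_adapted (@adapted_card_memory R n).
  + move=> n; apply: measurable_funD => //; apply: measurableT_comp => //.
    exact: measurable_adapted (@adapted_excess R n).
  + by move=> n w; exact: card_memory_deviation.
  + by move=> n w; rewrite addr_ge0.
  + by move=> n; have [M BM] := majorant_bounded R n; exists M => w; exact: BM.
  + move=> n n0; exact: expectation_size_bound.
  + apply/cvgryPge => A; near=> n.
    rewrite -ler_pdivrMl//; apply: le_trans (ler_norm _) _.
    rewrite -sqrtr_sqr ler_wsqrtr//.
    by near: n; exact: nbhs_infty_ger.
- (* The expectation is of order [sqrt n], so one logarithm suffices. *)
  exists 1 => //.
  have C1 n : 1 * (ln n%:R) `^ 1 * Num.sqrt n%:R = (ln n%:R) `^ 1 * Num.sqrt n%:R :> R.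
    by rewrite mul1r.
  under eq_fun do under eq_set do rewrite C1.
  apply: (markov_whp (B := fun n w => potential n (X ^~ w) +
      idle_count n (X ^~ w)) (K := 2 + expR 1 ^+ 2)).
  + by move=> n; exact: measurable_adapted (@adapted_card_symdiff R n).
  + exact: mpi.
  + by move=> n w; exact: card_symdiff.
  + by move=> n w; exact: pi0.
  + move=> n; have [M BM] := majorant_bounded R n; exists M => w.
    apply: le_trans (BM (X ^~ w)); rewrite [leLHS]ger0_norm ?pi0//.
    by apply: le_trans (ler_norm _); rewrite lerDl.
  + by move=> n n0; exact: expectation_symdiff_bound.
  + apply/cvgryPge => A; near=> n.
    have n1 : 1 <= n%:R :> R by near: n; exact: nbhs_infty_ger.
    rewrite powRr1 ?ln_ge0// -[A]expRK ler_ln ?posrE ?expR_gt0//.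
      by near: n; exact: nbhs_infty_ger.
    exact: lt_le_trans n1.
Unshelve. all: by end_near.
Qed.
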